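(* Let $(G,+)$ be a countable abelian group whose doubling subgroup $2G=\{g+g:g\in G\}$ has finite index in $G$. Then $G$ is square absolutely continuous.
   Context: A (left) Følner sequence in a countable group $G$ (here written additively) is a sequence $\Phi=(\Phi_N)_{N\in\mathbb{N}}$ of finite (nonempty) subsets of $G$ with $\lim_{N\to\infty}|(g+\Phi_N)\cap\Phi_N|/|\Phi_N|=1$ for every $g\in G$. $G$ is amenable if it admits such a sequence. An amenable group $G$, written additively, is square absolutely continuous if it admits two Følner sequences $\Phi=(\Phi_N)_{N}$ and $\Psi=(\Psi_N)_{N}$ such that: for any $\varepsilon>0$ there exists $\delta>0$ such that for any $u:G\to[0,1]$ with $\limsup_{N\to\infty}\frac{1}{|\Phi_N|}\sum_{g\in\Phi_N}u(g)<\delta$ we have $\limsup_{N\to\infty}\frac{1}{|\Psi_N|}\sum_{g\in\Psi_N}u(2g)<\varepsilon$, where $2g=g+g$. *)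

(* Defs.v *)
From mathcomp Require Import all_boot all_order all_algebra finmap.
From mathcomp Require Import all_classical all_reals all_analysis.
Import Order.TTheory GRing.Theory Num.Theory.
Import numFieldNormedType.Exports.

Set Implicit Arguments.
Unset Strict Implicit.
Unset Printing Implicit Defensive.

Local Open Scope classical_set_scope.
Local Open Scope ring_scope.

Definition ftranslate (G : zmodType) (g : G) (A : {fset G}) : {fset G} :=
  [fset (g + x)%R | x in A]%fset.

Definition folner (R : realType) (G : zmodType) (Phi : nat -> {fset G}) : Prop :=
  (forall N, Phi N != fset0) /\
  forall g : G,
    (#|` (ftranslate g (Phi N) `&` Phi N)%fset |%:R / #|` Phi N|%:R : R)
      @[N --> \oo] --> (1 : R).

Definition favg (R : realType) (G : zmodType) (A : {fset G}) (f : G -> R) : R :=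
  (#|` A|%:R)^-1 * \sum_(g <- A) f g.

(* Amenability of G is the existence of a Følner sequence, so it is subsumed by
   the existence of Phi.  The real-valued [limn_sup] is meaningful only for
   bounded sequences; here all averages lie in [0, 1]. *)
Definition square_absolutely_continuous (R : realType) (G : zmodType) : Prop :=
  exists Phi Psi : nat -> {fset G},
    [/\ folner R Phi, folner R Psi &
      forall eps : R, 0 < eps -> exists2 delta : R, 0 < delta &
        forall u : G -> R, (forall g, 0 <= u g <= 1) ->
          limn_sup (fun N => favg (Phi N) u) < delta ->
          limn_sup (fun N => favg (Psi N) (fun g => u (g + g))) < eps].

Definition doubling_subgroup (G : zmodType) : set G := [set g + g | g in [set: G]].
Arguments doubling_subgroup : clear implicits.

(* [H] is a plain set: this is the index of [H] when [H] is a subgroup. *)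
Definition finite_index (G : zmodType) (H : set G) : Prop :=
  finite_set (range (fun g : G => [set g + h | h in H])).

(* Main.v *)
(** Write [H = 2G] and let [T] be a finite set of representatives of [G / H].
    Take [F_N] in [H], Folner for [H], a section [s] of doubling over [H], and
    then a finite set [K_N] in [G[2]] almost invariant under the finitely many
    cocycle values [g + s f - s (2g + f)] with [f] in [F_N].  Then
    [Phi_N = T + F_N] and [Psi_N = s (F_N) + K_N] are Folner in [G], and doubling
    maps [Psi_N] onto [F_N] with all fibres of size [#|K_N|].  Hence the average
    of [u (2g)] over [Psi_N] is the average of [u] over [F_N], which is at most
    [#|T|] times its average over [Phi_N].  The almost invariant sets are boxes
    [{sum_i n_i s_i : 0 <= n_i < m}], whose cardinality is polynomial in [m]. *)
Require Import Defs.
From mathcomp Require Import all_boot all_order all_algebra finmap.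
From mathcomp Require Import all_classical all_reals all_analysis.
From mathcomp Require Import zify.
Import Order.TTheory GRing.Theory Num.Theory.
Import numFieldNormedType.Exports.

Set Implicit Arguments.
Unset Strict Implicit.
Unset Printing Implicit Defensive.

Local Open Scope classical_set_scope.
Local Open Scope ring_scope.

(** * Slow steps of polynomially bounded sequences *)

Lemma double_expn_le (n : nat) : (0 < n)%N -> (2 * n ^ n <= n.+1 ^ n)%N.
Proof.
(* Bernoulli's inequality (1 + 1/n)^m >= 1 + m/n without denominators; m = n gives the factor 2. *)
have bern m : (n ^ m * (n + m) <= n * n.+1 ^ m)%N.
  elim: m => [|m IH]; first by rewrite !expn0 addn0 muln1 mul1n.
  rewrite !expnS; apply: (@leq_trans (n.+1 * (n ^ m * (n + m)))%N).
    by have := leq0n (n ^ m * m)%N; nia.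
  by rewrite [leqRHS]mulnCA leq_mul2l IH orbT.
move=> n0.
rewrite -(leq_pmul2l n0); apply: leq_trans (bern n); rewrite addnn -mul2n; nia.
Qed.

(* Bernoulli turns [n] consecutive increases by the factor [1 + 1/n] into a
   doubling, so a sequence increasing by that factor at each step cannot be
   bounded by [m ^ d]. *)
Lemma poly_growth_slow_step (a : nat -> nat) (d n : nat) :
  (0 < n)%N -> (0 < a 1)%N -> (forall m, a m <= m ^ d)%N ->
  exists2 m, (0 < m)%N & (n * a m.+1 <= n.+1 * a m)%N.
Proof.
move=> n0 a1 ad; apply: contrapT => nex.
have step m : (0 < m)%N -> (n.+1 * a m <= n * a m.+1)%N.
  by move=> m0; rewrite leqNgt; apply/negP => /ltnW h; apply: nex; exists m.
have steps j m : (0 < m)%N -> (n.+1 ^ j * a m <= n ^ j * a (m + j))%N.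
  move=> m0; elim: j => [|j IH]; first by rewrite addn0.
  rewrite addnS !expnS -mulnA (leq_trans (leq_mul (leqnn _) IH)) //.
  rewrite mulnCA -mulnA [leqRHS]mulnCA leq_mul // step //.
  by rewrite addn_gt0 m0.
have double m : (0 < m)%N -> (2 * a m <= a (m + n))%N.
  move=> m0; have nn : (0 < n ^ n)%N by rewrite expn_gt0 n0.
  rewrite -(leq_pmul2l nn) (leq_trans _ (steps n m m0)) // mulnCA mulnA.
  by rewrite leq_mul2r double_expn_le ?orbT.
have doubles j : (2 ^ j <= (1 + j * n) ^ d)%N.
  rewrite (leq_trans _ (ad _)) //; elim: j => [|j IH]; first by rewrite addn0.
  rewrite expnS (mulSn j) (addnC n) addnA (leq_trans _ (double _ _)) //.
  by rewrite leq_mul.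
(* Take j = 2^i and compare exponents of 2, using 1 + 2^i n <= 2^(i+n+1): the right side becomes
   linear in i. *)
have doubles_exp i : (2 ^ i <= (i + n.+1) * d)%N.
  rewrite -(@leq_exp2l 2) // (leq_trans (doubles _)) // expnM.
  have [->|d0] := posnP d; first by rewrite !expn0.
  rewrite leq_exp2r // expnD (@leq_trans (2 ^ i * n.+1)%N) //.
    by rewrite mulnS leq_add2r expn_gt0.
  by rewrite leq_mul2l (ltnW (ltn_expl _ _)) ?orbT.
(* With i = 2k the left side is p^2 for p = 2^k > k, and (k+1)^2 already exceeds (2k+n+1)d. *)
have := doubles_exp ((n + 3) * d * 2)%N; set k := ((n + 3) * d)%N.
rewrite mulnC expnM -[(2 ^ 2)%N]/(2 * 2)%N expnMn.
have := ltn_expl k (isT : 1 < 2)%N; set p := (2 ^ k)%N => kp.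
have : (k.+1 * k.+1 <= p * p)%N by rewrite leq_mul.
rewrite /k; nia.
Qed.

(** * The Følner condition as a count of escaping points *)

Section Defect.
Variable G : zmodType.
Implicit Types (g : G) (A : {fset G}).

Definition defect g A : nat := count (fun x => g + x \notin A) A.

Lemma card_translate_cap g A :
  (#|` (ftranslate g A `&` A)%fset| + defect g A = #|` A|)%N.
Proof.
rewrite /defect -[RHS](count_predC (fun x => g + x \in A)); congr addn.
rewrite -size_filter.
rewrite -(size_map (fun x => g + x)); apply: perm_size; apply: uniq_perm.
- exact: fset_uniq.
- by rewrite map_inj_uniq ?filter_uniq ?fset_uniq //; exact: addrI.
move=> y; rewrite in_fsetI; apply/andP/mapP => [[/imfsetP[x /= xA ->] yA]|].
  by exists x => //; rewrite mem_filter yA.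
move=> [x]; rewrite mem_filter => /andP[gx xA] ->; split => //.
by apply/imfsetP; exists x.
Qed.

Lemma defect_le g A (s : seq G) :
  {subset [seq x <- A | g + x \notin A] <= s} -> (defect g A <= size s)%N.
Proof.
by move=> h; rewrite /defect -size_filter uniq_leq_size ?filter_uniq ?fset_uniq.
Qed.

(** By [card_translate_cap], 1 minus the Følner quotient is the defect divided by the cardinality,
    and this is eventually at most 1/n for every positive n. *)
Lemma folner_of_defect (R : realType) (A : nat -> {fset G}) :
  (forall N, A N != fset0) ->
  (forall g n, \forall N \near \oo, (n * defect g (A N) <= #|` A N|)%N) ->
  folner R A.
Proof.
move=> A0 hA; split => // g.
have A0R N : (0 : R) < #|` A N|%:R by rewrite ltr0n cardfs_gt0.
apply/cvgrPdist_le => e e0.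
have [n _ /(_ n (leqnn _)) ne] := near_infty_natSinv_lt (PosNum e0).
near=> N.
have := card_translate_cap g (A N).
set c := #|` (_ `&` _)%fset| => hc.
rewrite -[X in X - _](divff (lt0r_neq0 (A0R N))) -mulrBl -hc natrD addrC addKr.
rewrite ger0_norm ?divr_ge0 // -natrD hc ler_pdivrMr //.
have : (n.+1 * defect g (A N) <= #|` A N|)%N by near: N; exact: hA.
rewrite -(ler_nat R) natrM mulrC -ler_pdivlMr // => /le_trans; apply.
by rewrite mulrC ler_wpM2r // ltW.
Unshelve. all: by end_near.
Qed.

End Defect.

(** * Almost invariant boxes *)

Section GrowthBoxes.
Variable G : zmodType.

(** Different coefficient vectors may give the same point, for instance under torsion, so only an
    upper bound on the cardinality is available. *)
Fixpoint box (S : seq G) (m : nat) : {fset G} :=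
  if S is s :: S' then
    [fset x in [seq (s *+ i + x)%R | i <- iota 0 m, x <- box S' m]]%fset
  else [fset 0]%fset.

Lemma box_consP (s : G) S m x :
  reflect (exists i y, [/\ (i < m)%N, y \in box S m & x = s *+ i + y])
          (x \in box (s :: S) m).
Proof.
rewrite /= in_fset; apply: (iffP allpairsPdep) => [[i [y]]|[i [y]]].
  by rewrite mem_iota => -[/= im yS ->]; exists i, y.
by move=> [im yS ->]; exists i, y; rewrite mem_iota.
Qed.

Lemma card_box_le S m : (#|` box S m| <= m ^ size S)%N.
Proof.
elim: S => [|s S IH] /=; first by rewrite cardfs1.
rewrite card_fseq (leq_trans (size_undup _)) // size_allpairs size_iota expnS.
by rewrite leq_mul.
Qed.

Lemma box0 S m : (0 < m)%N -> 0 \in box S m.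
Proof.
move=> m0; elim: S => [|s S IH]; first by rewrite inE.
by apply/box_consP; exists 0%N, 0; rewrite mulr0n add0r.
Qed.

Lemma box_sub (P : set G) S m : P 0 -> (forall x y, P x -> P y -> P (x + y)) ->
  {in S, forall s, P s} -> {in box S m, forall x, P x}.
Proof.
move=> P0 PD; elim: S => [|s S IH] PS x; first by rewrite inE => /eqP ->.
move=> /box_consP[i [y [_ yS ->]]]; apply: (PD); last first.
  by apply: IH yS => z zS; apply: PS; rewrite inE zS orbT.
have Ps : P s by apply: PS; rewrite mem_head.
by elim: i => [|i IHi]; rewrite ?mulr0n // mulrS; exact: PD.
Qed.

Lemma box_mono S m : {subset box S m <= box S m.+1}.
Proof.
elim: S => [|s S IH] x // /box_consP[i [y [im yS ->]]].
by apply/box_consP; exists i, y; split; [exact: ltnW | exact: IH|].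
Qed.

Lemma box_shift (S : seq G) m s x : s \in S -> x \in box S m -> s + x \in box S m.+1.
Proof.
elim: S x => [|t S IH] x //; rewrite inE => /predU1P[->|sS].
  move=> /box_consP[i [y [im yS ->]]]; apply/box_consP.
  by exists i.+1, y; split; [|exact: box_mono|rewrite addrA mulrS].
move=> /box_consP[i [y [im yS ->]]]; apply/box_consP; exists i, (s + y).
by rewrite addrCA; split; [exact: ltnW | exact: IH|].
Qed.

(** The translates by [s] that escape [box S m] are distinct points of [box S m.+1] outside
    [box S m], so slow growth forces a small defect. *)
Lemma defect_box (S : seq G) m s : s \in S ->
  (defect s (box S m) + #|` box S m| <= #|` box S m.+1|)%N.
Proof.
move=> sS; rewrite /defect -size_filter -(size_map (fun x => s + x)) -size_cat.
apply: uniq_leq_size.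
  rewrite cat_uniq map_inj_uniq ?filter_uniq ?fset_uniq ?andbT //=.
  apply/hasPn => y yB; apply/mapP => -[x]; rewrite mem_filter => /andP[h _] yE.
  by rewrite -yE yB in h.
move=> y; rewrite mem_cat => /orP[/mapP[x]|]; last exact: box_mono.
by rewrite mem_filter => /andP[_ xB] ->; exact: box_shift.
Qed.

(** Coefficients in a box are non-negative, so [P] need only be a submonoid. It will be 2G, then the
    2-torsion. *)
Lemma almost_invariant_subset (P : set G) (S : seq G) (n : nat) :
  P 0 -> (forall x y, P x -> P y -> P (x + y)) -> {in S, forall s, P s} ->
  exists A : {fset G}, [/\ A != fset0, {in A, forall x, P x} &
    {in S, forall s, (n * defect s A <= #|` A|)%N}].
Proof.
move=> P0 PD PS.
(* [n.+1] keeps the parameter of [poly_growth_slow_step] positive when n = 0. *)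
have [m m0 hm] : exists2 m, (0 < m)%N &
    (n.+1 * #|` box S m.+1| <= n.+2 * #|` box S m|)%N.
  apply: (@poly_growth_slow_step (fun m => #|` box S m|) (size S)) => //.
    by rewrite cardfs_gt0; apply/fset0Pn; exists 0; exact: box0.
  exact: card_box_le.
exists (box S m); split.
- by apply/fset0Pn; exists 0; exact: box0.
- exact: box_sub.
move=> s sS; have := defect_box m sS; move: hm.
set d := defect _ _; set a := #|` _|; set b := #|` _|; nia.
Qed.

End GrowthBoxes.

(** * Upper limits and averages *)

Lemma limn_sup_lt_scale (R : realType) (a b : R ^nat) (k d : R) :
  0 < k -> bounded_fun a -> bounded_fun b -> (forall n, b n <= k * a n) ->
  limn_sup a < d -> limn_sup b < k * d.
Proof.
move=> k0 ba bb ab; rewrite !limn_supE // => ad.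
(* The upper limit is the infimum of the suprema of tails, so some tail of [a] has supremum below
   [d]; it controls the same tail of [b]. *)
have [_ [N _ <-] aN] : exists2 y, range (sups a) y & y < d.
  by apply: inf_lt => //; exists (sups a 0%N), 0%N.
apply: (@le_lt_trans _ _ (sups b N)).
  by apply: ge_inf; [exact: bounded_fun_has_lbound_sups | exists N].
apply: (@le_lt_trans _ _ (k * sups a N)); last by rewrite ltr_pM2l.
apply: ge_sup; first by exists (b N), N => /=.
move=> _ [n /= Nn <-]; rewrite (le_trans (ab n)) // ler_pM2l //.
apply: ub_le_sup; last by exists n.
have [M hM] := bounded_fun_has_ubound ba.
by exists M => _ [i _ <-]; apply: hM; exists i.
Qed.

Section Averages.
Variables (R : realType) (G : zmodType).
Implicit Types (A B : {fset G}) (u : G -> R).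

Lemma favg_itv A u : (forall g, 0 <= u g <= 1) -> 0 <= favg A u <= 1.
Proof.
move=> u01; have u0 g : 0 <= u g by case/andP: (u01 g).
have u1 g : u g <= 1 by case/andP: (u01 g).
rewrite /favg mulr_ge0 ?sumr_ge0 ?invr_ge0 //=.
have [A0|A0] := posnP #|` A|; first by rewrite A0 invr0 mul0r.
rewrite ler_pdivrMl ?ltr0n // mulr1.
rewrite (le_trans (ler_sum _ (fun g _ => u1 g))) // big_const_seq count_predT.
by rewrite iter_addr_0.
Qed.

Lemma bounded_favg (A : nat -> {fset G}) u :
  (forall g, 0 <= u g <= 1) -> bounded_fun (fun N => favg (A N) u).
Proof.
move=> u01; exists 1; split => // M M1 N _ /=.
have /andP[a0 a1] := favg_itv (A N) u01.
by rewrite ger0_norm // (le_trans a1) // ltW.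
Qed.

Lemma favg_subset_le A B (k : nat) u : A != fset0 -> (A `<=` B)%fset ->
  (#|` B| <= k * #|` A|)%N -> (forall g, 0 <= u g) ->
  favg A u <= k%:R * favg B u.
Proof.
move=> A0 AB cB u0; have A0R : (0 : R) < #|` A|%:R by rewrite ltr0n cardfs_gt0.
have B0R : (0 : R) < #|` B|%:R.
  by rewrite (lt_le_trans A0R) // ler_nat fsubset_leq_card.
rewrite /favg mulrA ler_pM ?sumr_ge0 ?invr_ge0 ?ler0n //.
  by rewrite ler_pdivlMr // ler_pdivrMl // mulrC -natrM ler_nat.
rewrite (perm_big [seq x <- B | x \in A]).
  by rewrite big_filter [leRHS](bigID (mem A)) /= lerDl sumr_ge0.
apply: uniq_perm; rewrite ?filter_uniq ?fset_uniq // => x.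
by rewrite mem_filter; case: (boolP (x \in A)) => // /(fsubsetP AB) ->.
Qed.

End Averages.

(** * Sumsets T + F and lifts s(F) + K *)

Section SumsetAndLift.
Variable G : zmodType.
Implicit Types (F K : {fset G}) (T : seq G).

Definition sumset T F : {fset G} :=
  [fset x in [seq (t + f)%R | t <- T, f <- F]]%fset.

Lemma sumsetP T F x :
  reflect (exists t f, [/\ t \in T, f \in F & x = t + f]) (x \in sumset T F).
Proof. by rewrite in_fset; exact: allpairsPdep. Qed.

Lemma card_sumset_le T F : (#|` sumset T F| <= size T * #|` F|)%N.
Proof. by rewrite card_fseq (leq_trans (size_undup _)) // size_allpairs. Qed.

Lemma sub_sumset T F : 0 \in T -> (F `<=` sumset T F)%fset.
Proof.
move=> T0; apply/fsubsetP => f fF; apply/sumsetP.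
by exists 0, f; rewrite add0r.
Qed.

(** Write g + (t + f) = (g + t - h t) + (h t + f): the first term stays in [T], so a point escapes
    only if [h t + f] leaves [F]. *)
Lemma defect_sumset T F g (h : G -> G) :
  {in T, forall t, g + t - h t \in T} ->
  (defect g (sumset T F) <= \sum_(t <- T) defect (h t) F)%N.
Proof.
move=> hT; pose bad t := [seq t + f | f <- F & h t + f \notin F].
suff -> : (\sum_(t <- T) defect (h t) F = size (flatten [seq bad t | t <- T]))%N.
  apply: defect_le => x; rewrite mem_filter => /andP[gx /sumsetP[t [f [tT fF xE]]]].
  apply/flattenP; exists (bad t); first exact: map_f.
  apply/mapP; exists f => //; rewrite mem_filter fF andbT.
  apply: contraNN gx => hf; apply/sumsetP; exists (g + t - h t), (h t + f).
  by split => //; [exact: hT | rewrite xE addrA subrKA].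
rewrite size_flatten /shape -map_comp sumnE big_map; apply: eq_bigr => t _.
by rewrite /= size_map size_filter.
Qed.

Variable s : G -> G.

Definition lift_fset F K : {fset G} :=
  [fset x in [seq (s f + k)%R | f <- F, k <- K]]%fset.

Lemma lift_fsetP F K x :
  reflect (exists f k, [/\ f \in F, k \in K & x = s f + k]) (x \in lift_fset F K).
Proof. by rewrite in_fset; exact: allpairsPdep. Qed.

(** Write g + s f + k = s (2g + f) + (c f + k), with c the cocycle. An escape means that 2g + f
    leaves [F], whatever [k] is, or that c f + k leaves [K]. *)
Lemma defect_lift F K g :
  (defect g (lift_fset F K) <= defect (g + g) F * #|` K| +
     \sum_(f <- F) defect (g + s f - s (g + g + f)) K)%N.
Proof.
pose c f := g + s f - s (g + g + f).
pose bad f := [seq s f + k | k <- K & c f + k \notin K].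
pose bad1 := [seq s f + k | f <- [seq f <- F | g + g + f \notin F], k <- K].
suff -> : (\sum_(f <- F) defect (c f) K = size (flatten [seq bad f | f <- F]))%N.
  rewrite /defect -[count _ F]size_filter -(size_allpairs (fun f k => s f + k)).
  rewrite -size_cat; apply: defect_le => x; rewrite mem_filter mem_cat.
  move=> /andP[gx /lift_fsetP[f [k [fF kK xE]]]].
  have [hf|hf] := boolP (g + g + f \in F); last first.
    by apply/orP; left; apply/allpairsPdep; exists f, k; rewrite mem_filter hf.
  apply/orP; right; apply/flattenP; exists (bad f); first exact: map_f.
  apply/mapP; exists k => //; rewrite mem_filter kK andbT.
  apply: contraNN gx => ck; apply/lift_fsetP; exists (g + g + f), (c f + k).
  by split => //; rewrite xE /c addrA [RHS]addrA subrKC.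
rewrite size_flatten /shape -map_comp sumnE big_map; apply: eq_bigr => f _.
by rewrite /= size_map size_filter.
Qed.

Section DoublingLift.
Variables F K : {fset G}.
Hypothesis sF : {in F, forall f, s f + s f = f}.
Hypothesis K2 : {in K, forall k, k + k = 0}.

Lemma lift_double f k : f \in F -> k \in K -> (s f + k) + (s f + k) = f.
Proof. by move=> fF kK; rewrite addrACA sF // K2 // addr0. Qed.

(** The sums are pairwise distinct: doubling s f + k recovers [f], and cancelling s f then recovers
    [k]. *)
Lemma perm_lift_fset :
  perm_eq (lift_fset F K) [seq s f + k | f <- F, k <- K].
Proof.
apply: uniq_perm; rewrite ?fset_uniq //; last by move=> x; rewrite in_fset.
apply: allpairs_uniq; rewrite ?fset_uniq // => p q /allpairsPdep[f [k [fF kK ->]]].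
move=> /allpairsPdep[f' [k' [f'F k'K ->]]] /= E.
have ff' : f = f' by rewrite -(lift_double fF kK) -(lift_double f'F k'K) E.
by rewrite ff' in E *; rewrite (addrI _ E).
Qed.

Lemma card_lift_fset : #|` lift_fset F K| = (#|` F| * #|` K|)%N.
Proof. by rewrite (perm_size perm_lift_fset) size_allpairs. Qed.

Lemma favg_lift_double (R : realType) (u : G -> R) : K != fset0 ->
  favg (lift_fset F K) (fun g => u (g + g)) = favg F u.
Proof.
move=> K0; rewrite /favg card_lift_fset (perm_big _ perm_lift_fset) /=.
rewrite big_allpairs_dep /=.
have -> : \sum_(f <- F) \sum_(k <- K) u (s f + k + (s f + k)) =
    (\sum_(f <- F) u f) * #|` K|%:R.
  rewrite mulr_suml; apply: eq_big_seq => f fF.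
  rewrite (eq_big_seq (fun=> u f)) => [|k kK]; last by rewrite lift_double.
  by rewrite big_const_seq count_predT iter_addr_0 mulr_natr.
rewrite natrM invfM -mulrA; congr (_ * _); rewrite mulrC mulfK //.
by rewrite pnatr_eq0 cardfs_eq0.
Qed.

End DoublingLift.
End SumsetAndLift.

Lemma leq_mul_sum (T : eqType) (r : seq T) (E : T -> nat) (c M : nat) :
  {in r, forall t, c * E t <= M}%N -> (c * \sum_(t <- r) E t <= size r * M)%N.
Proof.
elim: r => [|t r IH] rM; first by rewrite big_nil muln0.
rewrite big_cons mulnDr mulSn leq_add ?rM ?mem_head //.
by apply: IH => x xr; apply: rM; rewrite inE xr orbT.
Qed.

Lemma near_in_seq (T : eqType) (s : seq T) (P : T -> nat -> Prop) :
  {in s, forall t, \forall N \near \oo, P t N} ->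
  \forall N \near \oo, {in s, forall t, P t N}.
Proof.
elim: s => [|t s IH] Ps; first by apply: nearW => N x; rewrite in_nil.
have h1 : \forall N \near \oo, P t N by apply: Ps; exact: mem_head.
have h2 : \forall N \near \oo, {in s, forall t, P t N}.
  by apply: IH => x xs; apply: Ps; rewrite inE xs orbT.
by apply: filterS2 h1 h2 => N Pt PsN x; rewrite inE => /predU1P[->|/PsN].
Qed.

(** * The doubling subgroup, its cosets and halving *)

Section Doubling.
Variable G : zmodType.

Lemma doubling_subgroup0 : doubling_subgroup G 0.
Proof. by exists 0 => //; rewrite addr0. Qed.

Lemma doubling_subgroupD x y : doubling_subgroup G x -> doubling_subgroup G y ->
  doubling_subgroup G (x + y).
Proof. by move=> [a _ <-] [b _ <-]; exists (a + b) => //; rewrite addrACA. Qed.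

Lemma doubling_subgroupN x : doubling_subgroup G x -> doubling_subgroup G (- x).
Proof. by move=> [a _ <-]; exists (- a) => //; rewrite opprD. Qed.

(** A chosen section of doubling over 2G, with value 0 elsewhere. It need not be additive, hence the
    cocycle below. *)
Definition half (x : G) : G := xget 0 [set y | y + y = x].

Lemma halfK x : doubling_subgroup G x -> half x + half x = x.
Proof.
by move=> [a _ ax]; apply: (xgetPex 0 (P := [set y | y + y = x])); exists a.
Qed.

Lemma half_cocycle g f : doubling_subgroup G f ->
  let c := g + half f - half (g + g + f) in c + c = 0.
Proof.
move=> Hf /=; have Hgf : doubling_subgroup G (g + g + f).
  by apply: doubling_subgroupD => //; exists g.
by rewrite addrACA -opprD halfK // addrACA halfK // subrr.
Qed.

Lemma finite_index_representatives : finite_index (doubling_subgroup G) ->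
  exists2 T : seq G, 0 \in T &
    exists tau : G -> G, forall x, tau x \in T /\ doubling_subgroup G (x - tau x).
Proof.
move=> /(finite_image (fun C => xget 0 C)) /finite_seqP[T TE].
pose coset g := [set g + h | h in doubling_subgroup G].
(* Prepending 0 ensures that F is contained in T + F. A second representative of 2G is harmless, as
   [size T] only serves as an upper bound. *)
exists (0 :: T); first exact: mem_head.
exists (fun x => xget 0 (coset x)) => x; split.
  rewrite inE; apply/orP; right.
  suff : [set` T] (xget 0 (coset x)) by [].
  by rewrite -TE; exists (coset x) => //; exists x.
have [h Hh <-] : coset x (xget 0 (coset x)).
  apply: xgetPex; exists x; exists 0; rewrite ?addr0 //.
  exact: doubling_subgroup0.
by rewrite opprD addNKr; exact: doubling_subgroupN.
Qed.

End Doubling.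

(** * Construction of the two Følner sequences *)

Theorem theorem1p12 (R : realType) (G : zmodType)
    (countableG : countable [set: G])
    (finite_index_2G : finite_index (doubling_subgroup G)) :
  square_absolutely_continuous R G.
Proof.
have [idx idx_inj] := countable_injP _ countableG.
pose e i := xget (0 : G) [set g | idx g = i].
have eK g : e (idx g) = g.
  have : idx (e (idx g)) = idx g by apply: (xgetPex 0 (P := [set h | idx h = idx g])); exists g.
  by apply: idx_inj; rewrite inE.
have [T T0 [tau tauP]] := finite_index_representatives finite_index_2G.
have Tgt0 : (0 < size T)%N by case: T T0 {tauP}.
have exF N : exists A : {fset G}, [/\ A != fset0,
    {in A, forall x, doubling_subgroup G x} &
    forall i, (i < N)%N -> (N * defect (e i + e i) A <= #|` A|)%N].
  have [||s /mapP[i _ ->]|A [A0 AH AI]] := @almost_invariant_subset G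
      (doubling_subgroup G) [seq e i + e i | i <- iota 0 N] N.
  - exact: doubling_subgroup0.
  - exact: doubling_subgroupD.
  - by exists (e i).
  exists A; split => // i iN; apply: AI; apply/mapP.
  by exists i; rewrite // mem_iota.
have [F FP] := choice exF.
(* [K N] is chosen after [F N], since the cocycle values it must almost preserve are indexed by
   [F N]. *)
have exK N : exists A : {fset G}, [/\ A != fset0,
    {in A, forall x, x + x = 0} &
    forall i f, (i < N)%N -> f \in F N ->
      (N * defect (e i + half f - half (e i + e i + f)) A <= #|` A|)%N].
  have [_ FH _] := FP N.
  have [||s /allpairsPdep[i [f [_ fF ->]]]|A [A0 AH AI]] := @almost_invariant_subset G
      [set x | x + x = 0]
      [seq e i + half f - half (e i + e i + f) | i <- iota 0 N, f <- F N] N.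
  - by rewrite /= addr0.
  - by move=> x y /= x0 y0; rewrite addrACA x0 y0 addr0.
  - exact/half_cocycle/FH.
  exists A; split => // i f iN fF; apply: AI; apply/allpairsPdep.
  by exists i, f; rewrite mem_iota.
have [K KP] := choice exK.
have F_inv h n : doubling_subgroup G h ->
    \forall N \near \oo, (n * defect h (F N) <= #|` F N|)%N.
  move=> [g _ <-]; near=> N.
  have [_ _ /(_ (idx g))] := FP N; rewrite eK => FI.
  apply: leq_trans (FI _); last by near: N; exact: nbhs_infty_gt.
  by rewrite leq_mul2r; apply/orP; right; near: N; exact: nbhs_infty_ge.
have halfF N : {in F N, forall f, half f + half f = f}.
  by move=> f fF; have [_ FH _] := FP N; exact/halfK/FH.
exists (fun N => sumset T (F N)), (fun N => lift_fset (@half G) (F N) (K N)).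
split.
- have F_sub N : (F N `<=` sumset T (F N))%fset by exact: sub_sumset.
  apply: folner_of_defect => [N|g n].
    have [F0 _ _] := FP N; rewrite -cardfs_gt0.
    by rewrite (leq_trans _ (fsubset_leq_card (F_sub N))) // cardfs_gt0.
  (* The part of g + t in 2G; what remains is the representative [tau (g + t)]. *)
  pose h t := g + t - tau (g + t).
  (* The extra factor [size T] absorbs the number of terms in the sum over [T]. *)
  have hT : {in T, forall t, \forall N \near \oo,
      (size T * n * defect (h t) (F N) <= #|` F N|)%N}.
    by move=> t _; apply: F_inv; have [] := tauP (g + t).
  near=> N.
  apply: leq_trans (fsubset_leq_card (F_sub N)).
  rewrite -(leq_pmul2l Tgt0) mulnA.
  have : (defect g (sumset T (F N)) <= \sum_(t <- T) defect (h t) (F N))%N.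
    apply: defect_sumset => t _; rewrite /h opprB addrC subrK.
    by have [] := tauP (g + t).
  move=> /(leq_mul (leqnn (size T * n)%N))/leq_trans; apply.
  apply: leq_mul_sum.
  near: N; exact: near_in_seq.
- apply: folner_of_defect => [N|g n].
    rewrite -cardfs_gt0 card_lift_fset ?muln_gt0 ?cardfs_gt0 //.
      by have [-> _ _] := FP N; have [-> _ _] := KP N.
    by have [_ K2 _] := KP N.
  near=> N.
  have [_ K2 KI] := KP N; have [_ _ FI] := FP N.
  have gN : (idx g < N)%N by near: N; exact: nbhs_infty_gt.
  (* The factor 2 covers the two terms of [defect_lift], each at most |F||K|/N. *)
  have nN : (2 * n <= N)%N by near: N; exact: nbhs_infty_ge.
  rewrite card_lift_fset //.
  have D := defect_lift (@half G) (F N) (K N) g.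
  have DF := FI _ gN; rewrite eK in DF.
  have DK : (N * \sum_(f <- F N) defect (g + half f - half (g + g + f)) (K N)
      <= #|` F N| * #|` K N|)%N.
    by apply: leq_mul_sum => f fF; have := KI _ _ gN fF; rewrite eK.
  move: D DF DK; set d := defect _ _; set a := defect _ _; set S := (\sum_(_ <- _) _)%N.
  set x := #|` F N|; set y := #|` K N| => D DF DK.
  have : (N * d <= 2 * (x * y))%N.
    rewrite (leq_trans (leq_mul (leqnn N) D)) // mulnDr mulnA mul2n -addnn.
    by rewrite leq_add // leq_mul.
  have : (2 * n * d <= N * d)%N by rewrite leq_mul.
  lia.
(* The loss [size T] bounds the ratio of |T + F| to |F|. *)
move=> eps eps0; exists (eps / (size T)%:R); first by rewrite divr_gt0 ?ltr0n.
move=> u u01 uPhi.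
rewrite -[eps](@mulfVK _ (size T)%:R) ?pnatr_eq0 -?lt0n // mulrC.
apply: limn_sup_lt_scale uPhi; [by rewrite ltr0n|exact: bounded_favg| |].
  by apply: bounded_favg => g; exact: u01.
move=> N; have [F0 _ _] := FP N; have [K0 K2 _] := KP N.
rewrite favg_lift_double //; apply: favg_subset_le => //.
- exact: sub_sumset.
- exact: card_sumset_le.
- by move=> g; case/andP: (u01 g).
Unshelve. all: by end_near.
Qed.
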